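(* Consider the AoN equilibrium of the Gaussian-quadratic two-sender environment with correlation parameter $\alpha\in[0,1]$ described in the context. For given $p_0,p_1,p_2>0$ there exists a threshold $\bar p<\min\{p_1,p_2\}$ such that the receiver's payoff under full correlation ($\alpha=1$) is strictly larger than under independence ($\alpha=0$) if $p_{\mathrm c}>\bar p$.
   Context: Let $\omega_0\sim\mathcal N(0,1/p_0)$. There are signals $s_1,s_2,s_{\mathrm c}$, independent conditionally on $\omega_0$, with $s_k\sim\mathcal N(\omega_0,1/p_k)$ given $\omega_0$, for $k\in\{1,2,\mathrm c\}$, where $p_1,p_2,p_{\mathrm c}>0$. There are $n=2$ senders with components $$\omega_i=\frac{(1-\alpha)s_i+\alpha s_{\mathrm c}}{\sqrt{(1-\alpha)^2+\alpha^2}},\qquad i\in\{1,2\},$$ where $\alpha\in[0,1]$. The receiver chooses $a\in\mathbb R$ with utility $u(a,\omega_0)=-(a-\omega_0)^2$, so his stopping utility with given information is minus the conditional variance of $\omega_0$: write $U(\mu'(\omega_j))=-\mathrm{Var}(\omega_0\mid\omega_j)$ and $U(\mu'(\omega_1,\omega_2))=-\mathrm{Var}(\omega_0\mid\omega_1,\omega_2)$ (these are deterministic by Gaussianity). Senders compete for the receiver's attention over discrete rounds, each consultation costing the receiver $c>0$. In the AoN (All-or-Nothing) equilibrium, all information $(\omega_1,\omega_2)$ is transmitted to the receiver, and the expected total attention cost the receiver spends at sender $i$ equals the residual value $\bar v(\tilde\omega_i\mid\omega_j)=U(\mu'(\omega_1,\omega_2))-U(\mu'(\omega_j))$, $j\ne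 i$, of her component given the other component. Hence the receiver's payoff in the AoN equilibrium is $$U(\mu'(\omega_1,\omega_2))-\bar v(\tilde\omega_1\mid\omega_2)-\bar v(\tilde\omega_2\mid\omega_1),$$ and this expression is used for all $\alpha\in[0,1]$, including $\alpha=1$ (where $\omega_1=\omega_2=s_{\mathrm c}$ and the residual values are zero). *)

(* Defs.v *)
From HB Require Import structures.
From mathcomp Require Export all_boot all_order all_algebra.
From mathcomp Require Export all_classical all_reals all_analysis.

Set Implicit Arguments.
Unset Strict Implicit.
Unset Printing Implicit Defensive.

Import Order.TTheory GRing.Theory Num.Theory.
Import numFieldNormedType.Exports.

Local Open Scope classical_set_scope.
Local Open Scope ring_scope.

(* [Z] is a version of E[X | G], for a sub-sigma-algebra [G]. *)
Definition is_cond_expectation d (T : measurableType d) (R : realType)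
    (P : probability T R) (G : set (set T)) (X Z : T -> R) : Prop :=
  [/\ P.-integrable setT (EFin \o X),
      P.-integrable setT (EFin \o Z),
      (forall B : set R, measurable B -> G (Z @^-1` B)) &
      (forall A : set T, G A ->
         \int[P]_(t in A) (Z t)%:E = \int[P]_(t in A) (X t)%:E)%E].

(* [q] is a version of P(E | G). *)
Definition is_cond_probability d (T : measurableType d) (R : realType)
    (P : probability T R) (G : set (set T)) (E : set T) (q : T -> R) : Prop :=
  is_cond_expectation P G (\1_E : T -> R) q.

(* [V] is a version of Var(X | G) = E[(X - E[X | G])^2 | G]. *)
Definition is_cond_variance d (T : measurableType d) (R : realType)
    (P : probability T R) (G : set (set T)) (X V : T -> R) : Prop :=
  exists2 M : T -> R, is_cond_expectation P G X M &
    is_cond_expectation P G (fun t => (X t - M t) ^+ 2) V.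

(* The real number to which Var(X | G) is almost surely equal, when Var(X | G)
   is deterministic.  Versions agree almost surely and P has mass 1, so this
   number is then unique; the default 0 is taken only if Var(X | G) does not
   exist or is not deterministic. *)
Definition det_cond_variance d (T : measurableType d) (R : realType)
    (P : probability T R) (G : set (set T)) (X : T -> R) : R :=
  xget 0 [set v : R | is_cond_variance P G X (cst v)].

(* Under P, given X, Y is normal with mean X and precision p (i.e. with variance
   1/p: the second parameter of [normal_prob] is a standard deviation). *)
Definition cond_normal d (T : measurableType d) (R : realType)
    (P : probability T R) (X Y : T -> R) (p : R) : Prop :=
  forall B : set R, measurable B ->
    is_cond_probability P (g_sigma_algebra_preimage X) (Y @^-1` B)
      (fun t => fine (normal_prob (X t) (Num.sqrt (1 / p)) B)).

(* Mutual conditional independence of three variables given G; taking some of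
   the B's to be setT gives the product rule for the subfamilies. *)
Definition cond_independent3 d (T : measurableType d) (R : realType)
    (P : probability T R) (G : set (set T)) (Y1 Y2 Y3 : T -> R) : Prop :=
  forall B1 B2 B3 : set R, measurable B1 -> measurable B2 -> measurable B3 ->
  forall q1 q2 q3 : T -> R,
    is_cond_probability P G (Y1 @^-1` B1) q1 ->
    is_cond_probability P G (Y2 @^-1` B2) q2 ->
    is_cond_probability P G (Y3 @^-1` B3) q3 ->
    is_cond_probability P G (Y1 @^-1` B1 `&` Y2 @^-1` B2 `&` Y3 @^-1` B3)
      (fun t => q1 t * q2 t * q3 t).

Record gaussian_signals d (T : measurableType d) (R : realType)
    (P : probability T R) (p0 p1 p2 pc : R) (w0 s1 s2 sc : {RV P >-> R})
    : Prop := GaussianSignals {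
  state_normal : forall B : set R, measurable B ->
    distribution P w0 B = normal_prob 0 (Num.sqrt (1 / p0)) B ;
  signal1_normal : cond_normal P w0 s1 p1 ;
  signal2_normal : cond_normal P w0 s2 p2 ;
  signalc_normal : cond_normal P w0 sc pc ;
  signals_cond_independent :
    cond_independent3 P (g_sigma_algebra_preimage w0) s1 s2 sc
}.

Definition component (T : Type) (R : realType) (alpha : R) (s sc : T -> R)
    (t : T) : R :=
  ((1 - alpha) * s t + alpha * sc t)
    / Num.sqrt ((1 - alpha) ^+ 2 + alpha ^+ 2).

(* The receiver's utility from stopping with the information carried by Y:
   under u(a, w0) = - (a - w0)^2 it is minus the conditional variance of w0. *)
Definition stopping_utility d d' (T : measurableType d)
    (T' : measurableType d') (R : realType) (P : probability T R)
    (w0 : T -> R) (Y : T -> T') : R :=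
  - det_cond_variance P (g_sigma_algebra_preimage Y) w0.

(* Residual value, for the receiver, of the component wi given wj. *)
Definition residual_value d (T : measurableType d) (R : realType)
    (P : probability T R) (w0 wi wj : T -> R) : R :=
  stopping_utility P w0 (fun t => (wi t, wj t)) - stopping_utility P w0 wj.

(* All information is transmitted, and the expected attention cost spent at
   each sender is the residual value of her component. *)
Definition AoN_payoff d (T : measurableType d) (R : realType)
    (P : probability T R) (w0 s1 s2 sc : T -> R) (alpha : R) : R :=
  let w1 := component alpha s1 sc in
  let w2 := component alpha s2 sc in
  stopping_utility P w0 (fun t => (w1 t, w2 t))
    - residual_value P w0 w1 w2 - residual_value P w0 w2 w1.

(* Main.v *)
(* In precisions, the payoff is -1/(p0+pc) under full correlation and
   -L under independence, where L = 1/(p0+p1) + 1/(p0+p2) - 1/(p0+p1+p2), and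
   L exceeds both 1/(p0+p1) and 1/(p0+p2); hence pbar = 1/L - p0.

   The conditional variances come from Bayes' rule on densities: completing the
   square, the joint density of the state w0 and the observation Y factors as
   c(y) times the normal density of mean m(y) and precision p.  Hence w0 - m(Y)
   is independent of Y and N(0, 1/p), so that m(Y) is a version of E[w0 | Y] and
   the constant 1/p a version of Var(w0 | Y). *)

From HB Require Import structures.
From mathcomp Require Import ring lra measurable_realfun.
Require Import Defs.

Set Implicit Arguments.
Unset Strict Implicit.
Unset Printing Implicit Defensive.

Import Order.TTheory GRing.Theory Num.Theory.
Import numFieldNormedType.Exports.

Local Open Scope classical_set_scope.
Local Open Scope ring_scope.

(** The hypotheses on conditional laws only give probabilities of rectangles, [w0] in A and [Y] in
    B. Independence of the residual from [Y] concerns the sheared set of pairs (x, y) with x - m(y)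
    in A and y in B. The rectangle formula is therefore extended to all measurable sets by
    uniqueness of finite measures on a generating pi-system, and Tonelli is applied to the sheared
    set with x integrated first. Bayes' rule on densities is only run for one signal and for the
    pair ([s1], [s2]). Under full correlation the pair ([sc], [sc]) lives on the diagonal and has no
    density; it is treated through the sigma-algebra it generates, which is that of [sc]. *)

(** * Measures with a density *)

Section density.
Local Open Scope ereal_scope.
Context d (T : measurableType d) (R : realType).
Variables (mu nu : {measure set T -> \bar R}) (g : T -> R).
Hypotheses (mg : measurable_fun setT g) (g0 : forall x, (0 <= g x)%R).
Hypothesis nuE : forall A, measurable A -> nu A = \int[mu]_(x in A) (g x)%:E.

Import HBNNSimple.

Let integral_density_indic E : measurable E ->
  \int[nu]_x (\1_E x)%:E = \int[mu]_x ((\1_E x)%:E * (g x)%:E).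
Proof.
move=> mE; rewrite integral_indic// setIT nuE// integral_mkcond.
apply: eq_integral => x _; rewrite patchE indicE.
by case: ifPn => _; rewrite ?mul1e ?mul0e.
Qed.

Let integral_density_nnsfun (h : {nnsfun T >-> R}) :
  \int[nu]_x (h x)%:E = \int[mu]_x ((h x)%:E * (g x)%:E).
Proof.
have mEg : measurable_fun setT (EFin \o g) by exact/measurable_EFinP.
under [LHS]eq_integral do rewrite fimfunE -fsumEFin//.
rewrite [LHS]ge0_integral_fsum//; last 2 first.
  - by move=> r; exact/measurable_EFinP/measurableT_comp.
  - by move=> n x _; rewrite EFinM nnfun_muleindic_ge0.
under [RHS]eq_integral.
  move=> x xD; rewrite fimfunE -fsumEFin// muleC ge0_mule_fsumr; last first.
    by move=> r; rewrite EFinM nnfun_muleindic_ge0.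
  over.
rewrite [RHS]ge0_integral_fsum//; last 2 first.
  - move=> r; apply: emeasurable_funM => //.
    by apply/measurable_EFinP; do 2 apply/measurableT_comp => //.
  - move=> n x _; apply: mule_ge0; first by rewrite lee_fin.
    by rewrite EFinM nnfun_muleindic_ge0.
(* Only values [r] taken by [h] contribute, so [r] is nonnegative and may leave the integral. *)
apply: eq_fsbigr => r /[!inE] -[t _ htr].
have r0 : (0 <= r)%R by rewrite -htr.
have mI : measurable_fun setT (fun x => (\1_(h @^-1` [set r]) x)%:E : \bar R).
  exact/measurable_EFinP/measurable_indic.
under eq_integral do rewrite EFinM.
rewrite ge0_integralZl// integral_density_indic//.
rewrite -ge0_integralZl//.
- by apply: eq_integral => x _; rewrite EFinM muleA muleC.
- exact: emeasurable_funM.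
- by move=> x _; rewrite mule_ge0// lee_fin.
Qed.

(** Simple functions, then monotone convergence. Since [nu] is only required to agree with the
    density on measurable sets, this serves for normal laws, for restrictions (an indicator as
    density) and for multiples of a measure (a constant as density). *)
Lemma ge0_integral_density (f : T -> \bar R) : measurable_fun setT f ->
  (forall x, 0 <= f x) ->
  \int[nu]_x f x = \int[mu]_x (f x * (g x)%:E).
Proof.
move=> mf f0; pose f_ := nnsfun_approx measurableT mf.
have f_f x : EFin \o f_^~ x @ \oo --> f x by exact: cvg_nnsfun_approx.
have ndf x : {homo (f_^~ x) : a b / (a <= b)%N >-> (a <= b)%R}.
  by move=> a b ab; exact/lefP/nd_nnsfun_approx.
have mEg : measurable_fun setT (EFin \o g) by exact/measurable_EFinP.
transitivity (limn (fun n => \int[nu]_x (f_ n x)%:E)).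
  rewrite -monotone_convergence//=.
  - by apply: eq_integral => x _; apply/esym/cvg_lim => //; exact: f_f.
  - by move=> n; exact/measurable_EFinP.
  - by move=> n x _; rewrite lee_fin.
  - by move=> x _ a b ab; rewrite lee_fin ndf.
under eq_fun do rewrite integral_density_nnsfun.
rewrite -monotone_convergence//=.
- apply: eq_integral => x _; apply/cvg_lim => //.
  by apply: cvgeZr => //; exact: f_f.
- move=> n; apply: emeasurable_funM => //; exact/measurable_EFinP.
- by move=> n x _; rewrite mule_ge0 ?lee_fin.
- by move=> x _ a b ab; rewrite lee_wpmul2r ?lee_fin ?ndf.
Qed.

End density.

Section density_measure.
Local Open Scope ereal_scope.
Context d (T : measurableType d) (R : realType).
Variables (mu : {measure set T -> \bar R}) (g : T -> R).
Hypotheses (mg : measurable_fun setT g) (g0 : forall x, (0 <= g x)%R).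

(* The two proofs are arguments only so that the measure structure can be
   inferred from the term. *)
Definition density_measure of measurable_fun setT g & (forall x, (0 <= g x)%R) :=
  fun A => \int[mu]_(x in A) (g x)%:E.

Local Notation dens := (density_measure mg g0).

Let dens0 : dens set0 = 0. Proof. exact: integral_set0. Qed.

Let dens_ge0 A : 0 <= dens A.
Proof. by apply: integral_ge0 => x _; rewrite lee_fin. Qed.

Let dens_sigma_additive : semi_sigma_additive dens.
Proof.
move=> /= A mA tA mUA; rewrite /density_measure ge0_integral_bigcup//=.
- apply: is_cvg_ereal_nneg_natsum_cond => n _ _.
  by apply: integral_ge0 => x _; rewrite lee_fin.
- exact/measurable_EFinP/measurable_funTS.
- by move=> x _; rewrite lee_fin.
Qed.

HB.instance Definition _ := isMeasure.Build _ _ _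
  dens dens0 dens_ge0 dens_sigma_additive.

End density_measure.

(** * Finite measures are determined by rectangles *)

Section measure_prod_unique.
Local Open Scope ereal_scope.
Context d1 d2 (T1 : measurableType d1) (T2 : measurableType d2) (R : realType).
Variables m1 m2 : {measure set (T1 * T2) -> \bar R}.
Hypothesis m1_fin : m1 setT < +oo.
Hypothesis m12 : forall A B, measurable A -> measurable B ->
  m1 (A `*` B) = m2 (A `*` B).

(** Rectangles form a generating pi-system that contains the whole space; as [m1] is finite, the
    constant sequence [setT] is an admissible exhaustion. *)
Lemma measure_prod_unique X : measurable X -> m1 X = m2 X.
Proof.
apply: (measure_unique [set A `*` B | A in measurable & B in measurable]
    (fun=> setT)) => //.
- exact: measurable_prod_measurableType.
- move=> _ _ [A mA [B mB <-]] [A' mA' [B' mB' <-]].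
  exists (A `&` A'); first exact: measurableI.
  by exists (B `&` B'); [exact: measurableI|rewrite setXI].
- by move=> _; exists setT => //; exists setT => //; rewrite setXTT.
- by rewrite bigcup_const.
- by move=> _ [A mA [B mB <-]]; exact: m12.
Qed.

End measure_prod_unique.

(** * Moments of the normal distribution *)

Section normal_moments.
Context (R : realType).
Implicit Types (m s x : R) (A : set R).
Local Notation mu := (@lebesgue_measure R).

Lemma normal_pdf_shift m s x : s != 0 ->
  normal_pdf m s x = normal_pdf 0 s (x - m).
Proof. by move=> s0; rewrite !normal_pdfE// /normal_fun subr0. Qed.

Lemma lebesgue_measure_shift m A : measurable A ->
  pushforward mu ((fun x => x - m) : _ -> measurableTypeR R) A = mu A.
Proof.
move=> mA; apply/esym/lebesgue_measure_unique => //=.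
  exact: measurable_funB.
move=> _ _ [[a b]] _ <-.
rewrite /pushforward (_ : _ @^-1` _ = `]a + m, b + m]%classic).
  rewrite !lebesgue_measure_itv/= !lte_fin ltrD2r; case: ifP => // _.
  by rewrite -!EFinD; congr EFin; ring.
by apply/seteqP; split => x /=; rewrite !in_itv/= ltrBrDr lerBlDr.
Qed.

(** The right-hand side does not depend on [m]. With [m] the posterior mean at an observation, this
    is where the independence of residual and observation comes from. *)
Lemma normal_prob_shift m s A : s != 0 -> measurable A ->
  (\int[mu]_(x in [set x | A (x - m)%R]) (normal_pdf m s x)%:E =
   normal_prob 0 s A)%E.
Proof.
move=> s0 mA; rewrite /normal_prob.
have mm : measurable_fun setT ((fun x => x - m) : R -> measurableTypeR R).
  exact: measurable_funB.
under eq_integral do rewrite normal_pdf_shift//.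
transitivity (\int[pushforward mu ((fun x => (x - m)%R) : _ -> measurableTypeR R)]_(x in A)
   (normal_pdf 0 s x)%:E)%E.
  rewrite ge0_integral_pushforward//.
    by apply/measurable_EFinP/measurable_funTS; exact: measurable_normal_pdf.
  by move=> x _; rewrite lee_fin normal_pdf_ge0.
by apply: eq_measure_integral => B mB _; exact: lebesgue_measure_shift.
Qed.

Lemma normal_pdf_even s x : s != 0 -> normal_pdf 0 s (- x) = normal_pdf 0 s x.
Proof. by move=> s0; rewrite !normal_pdfE// /normal_fun !subr0 sqrrN. Qed.

Lemma normal_probN s A : s != 0 -> measurable A ->
  pushforward (normal_prob 0 s) (-%R : _ -> measurableTypeR R) A = normal_prob 0 s A.
Proof.
move=> s0 mA; rewrite /pushforward /normal_prob.
have mN : measurable_fun setT ((fun x => - x) : R -> measurableTypeR R).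
  exact: measurable_funN.
under eq_integral do rewrite -normal_pdf_even//.
transitivity (\int[pushforward mu ((fun x => (- x)%R) : _ -> measurableTypeR R)]_(x in A)
   (normal_pdf 0 s x)%:E)%E.
  rewrite ge0_integral_pushforward//.
    by apply/measurable_EFinP/measurable_funTS; exact: measurable_normal_pdf.
  by move=> x _; rewrite lee_fin normal_pdf_ge0.
by apply: eq_measure_integral => B mB _; exact: lebesgue_measureN.
Qed.

Lemma cvg_normal_pdf s : s != 0 -> normal_pdf 0 s x @[x --> +oo] --> (0 : R).
Proof.
move=> s0; rewrite normal_pdfE//.
(* Rescaling by [k] turns the exponent into that of [gauss_fun]. The square root keeps [k] positive
   even for negative [s], so x * k tends to +oo. *)
pose k := (Num.sqrt (s ^+ 2 *+ 2))^-1.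
have k0 : 0 < k by rewrite invr_gt0 sqrtr_gt0 pmulrn_lgt0 ?exprn_even_gt0.
rewrite (_ : (fun _ => _) = fun x => normal_peak s * gauss_fun (x * k)).
  rewrite -[X in _ --> X](mulr0 (normal_peak s)).
  apply: cvgM; first exact: cvg_cst.
  apply: (cvg_comp (fun x => x * k) (@gauss_fun R)); last exact: cvg_gauss_fun.
  exact: gt0_cvgMly.
apply/funext => x; rewrite /normal_fun /gauss_fun subr0 exprMn exprVn.
by rewrite sqr_sqrtr ?mulNr// pmulrn_lge0// sqr_ge0.
Qed.

Lemma is_derive_normal_pdf s x : s != 0 ->
  is_derive x 1 (normal_pdf 0 s) (- (x / s ^+ 2) * normal_pdf 0 s x).
Proof.
move=> s0; rewrite normal_pdfE// /normal_fun.
by apply: is_derive_eq; rewrite /GRing.scale/= subr0; field.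
Qed.

Lemma continuous_mul_normal_pdf s : s != 0 ->
  continuous (fun x => x * normal_pdf 0 s x).
Proof.
move=> s0 x; apply: (@cvgM _ _ _ _ idfun); first exact: cvg_id.
exact: continuous_normal_pdf.
Qed.

(** The function - s^2 * [normal_pdf 0 s] is an antiderivative of the integrand and vanishes at +oo;
    [0 <= a] makes the integrand nonnegative, as the improper fundamental theorem requires. *)
Lemma integral_mul_normal_pdf_tail s a : s != 0 -> 0 <= a ->
  (\int[mu]_(x in `[a, +oo[) (x * normal_pdf 0 s x)%:E =
   (s ^+ 2 * normal_pdf 0 s a)%:E)%E.
Proof.
move=> s0 a0; have ds x : is_derive x 1 (fun x => - s ^+ 2 * normal_pdf 0 s x)
    (x * normal_pdf 0 s x).
  have dx := is_derive_normal_pdf x s0; apply: is_derive_eq.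
  by rewrite /GRing.scale/=; field.
rewrite (@ge0_continuous_FTC2y _ _ (fun x => - s ^+ 2 * normal_pdf 0 s x) a 0).
- by rewrite -EFinB sub0r mulNr opprK.
- by move=> x ax; rewrite mulr_ge0 ?normal_pdf_ge0// (le_trans a0).
- by apply: continuous_subspaceT; exact: continuous_mul_normal_pdf.
- rewrite -[X in _ --> X](mulr0 (- s ^+ 2)).
  by apply: cvgM; [exact: cvg_cst|exact: cvg_normal_pdf].
- by move=> x _; have [] := ds x.
- apply: cvg_at_right_filter; apply: cvgM; first exact: cvg_cst.
  exact: continuous_normal_pdf.
- by move=> x _; rewrite derive1E; have [] := ds x.
Qed.

(* Tonelli on {0 <= a <= x}: writing x as the integral of 1 over [0, x], the
   second moment becomes the integral over a >= 0 of the first-moment tails. *)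
Lemma integral_sqr_normal_pdf s : s != 0 ->
  (\int[mu]_x (x ^+ 2 * normal_pdf 0 s x)%:E = (s ^+ 2)%:E)%E.
Proof.
move=> s0.
have c2 : continuous (fun x => x ^+ 2 * normal_pdf 0 s x).
  move=> x; apply: cvgM; first exact: exprn_continuous.
  exact: continuous_normal_pdf.
have pos0 : [set x : R | 0 <= x] = `[0, +oo[%classic by rewrite set_itvcy.
rewrite ge0_symfun_integralT//; last 2 first.
- by move=> x; rewrite mulr_ge0 ?normal_pdf_ge0 ?sqr_ge0.
- by move=> x /=; rewrite sqrrN normal_pdf_even.
pose f (z : R * R) : \bar R :=
  (if (0 <= z.2) && (z.2 <= z.1) then z.1 * normal_pdf 0 s z.1 else 0)%:E.
have mf : measurable_fun setT f.
  apply/measurable_EFinP; apply: measurable_fun_ifT => //.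
  - by apply: measurable_and; exact: measurable_fun_ler.
  - by apply: measurable_funM => //; apply: measurableT_comp => //;
      exact: measurable_normal_pdf.
have f0 z : (0 <= f z)%E.
  rewrite /f lee_fin; case: ifPn => // /andP[a0 ax].
  by rewrite mulr_ge0 ?normal_pdf_ge0// (le_trans a0).
have fx x : (\int[mu]_a f (x, a) =
    ((fun x => (x ^+ 2 * normal_pdf 0 s x)%:E) \_ [set x | (0 <= x)%R]) x)%E.
  transitivity (\int[mu]_(a in `[0%R, x]) (x * normal_pdf 0 s x)%:E)%E.
    rewrite [RHS]integral_mkcond; apply: eq_integral => a _.
    by rewrite patchE mem_setE in_itv/= /f/=; case: ifPn.
  rewrite integral_cst// [X in (_ * X)%E]lebesgue_measure_itv/= lte_fin patchE.
  case: ltP => x0.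
    rewrite mem_set/= ?ltW// oppr0 adde0 -EFinM.
    by congr EFin; ring.
  (* The interval length separates at 0 < x, the restriction at 0 <= x; they differ only at x = 0,
     where the integrand vanishes. *)
  rewrite mule0; case: ifPn => // /set_mem/= x0'.
  by rewrite (_ : x = 0) ?expr0n/= ?mul0r//; apply/le_anti/andP.
have fa a : (\int[mu]_x f (x, a) =
    ((s ^+ 2)%:E * ((fun a => (normal_pdf 0 s a)%:E) \_ [set x | (0 <= x)%R]) a))%E.
  rewrite patchE; case: ifPn => [/set_mem/= a0|/negP a0].
    rewrite -EFinM -integral_mul_normal_pdf_tail//.
    rewrite [RHS]integral_mkcond; apply: eq_integral => x _.
    by rewrite patchE mem_setE in_itv/= andbT /f/= a0/=; case: ifPn.
  rewrite mule0; apply: integral0_eq => x _; rewrite /f/=.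
  by rewrite ifF//; apply/negP => /andP[a0' _]; apply: a0; rewrite inE.
rewrite integral_mkcond; under eq_integral do rewrite -fx.
rewrite fubini_tonelli//; under eq_integral do rewrite fa.
rewrite ge0_integralZl//; last 3 first.
- apply/(measurable_restrictT _ _).1 => //; first by rewrite pos0.
  by apply/measurable_EFinP/measurable_funTS; exact: measurable_normal_pdf.
- by move=> x _; apply: erestrict_ge0 => // y _; rewrite lee_fin normal_pdf_ge0.
- by rewrite lee_fin sqr_ge0.
(* The factor 2 from the first use of evenness now doubles the half-line integral of the density
   back to its total mass 1. *)
rewrite -integral_mkcond muleCA -ge0_symfun_integralT.
- by rewrite integral_normal_pdf mule1.
- by move=> x; exact: normal_pdf_ge0.
- exact: continuous_normal_pdf.
- by move=> x /=; rewrite normal_pdf_even.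
Qed.

Lemma integral_sqr_normal_prob s : s != 0 ->
  (\int[normal_prob 0 s]_x (x ^+ 2)%:E = (s ^+ 2)%:E)%E.
Proof.
move=> s0; rewrite (@ge0_integral_density _ _ _ mu _ (normal_pdf 0 s))//.
- by under eq_integral do rewrite -EFinM; exact: integral_sqr_normal_pdf.
- exact: measurable_normal_pdf.
- by move=> x; exact: normal_pdf_ge0.
- by apply/measurable_EFinP; exact: measurable_funX.
- by move=> x; rewrite lee_fin sqr_ge0.
Qed.

(** The finite second moment suffices, because |x| <= 1 + x^2 and the total mass is 1. *)
Lemma integrable_normal_prob s : s != 0 ->
  (normal_prob 0 s).-integrable setT (fun x : R => x%:E).
Proof.
move=> s0; apply/integrableP; split; first exact/measurable_EFinP.
apply: (@le_lt_trans _ _ (\int[normal_prob 0 s]_x (1 + (x ^+ 2)%:E)))%E.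
  apply: ge0_le_integral => //.
  - by apply: measurableT_comp => //; exact/measurable_EFinP.
  - apply: emeasurable_funD => //.
    by apply/measurable_EFinP; exact: measurable_funX.
  - move=> x _; rewrite /= -EFinD lee_fin -(real_normK (num_real x)).
    by nra.
rewrite ge0_integralD//; last 2 first.
- by move=> x _; rewrite lee_fin sqr_ge0.
- by apply/measurable_EFinP; exact: measurable_funX.
rewrite integral_sqr_normal_prob// integral_cst// mul1e.
by rewrite [X in (X + _)%E](probability_setT (normal_prob 0 s)) ltry.
Qed.

(** By symmetry of the law the mean equals its own opposite; integrability makes it a finite number,
    hence 0. *)
Lemma integral_normal_prob s : s != 0 ->
  (\int[normal_prob 0 s]_x x%:E = 0)%E.
Proof.
move=> s0; have intx := integrable_normal_prob s0.
have mN : measurable_fun setT ((fun x => - x) : measurableTypeR R -> measurableTypeR R).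
  exact: measurable_funN.
have : (\int[normal_prob 0 s]_x x%:E = - \int[normal_prob 0 s]_x x%:E)%E.
  transitivity (\int[pushforward (normal_prob 0 s) ((fun x => (- x)%R) : _ -> measurableTypeR R)]_x
      x%:E)%E.
    by apply/esym/eq_measure_integral => A mA _; exact: normal_probN.
  rewrite integral_pushforward//; last exact: integrableN intx.
  rewrite preimage_setT -integralN//; last exact: integrable_add_def.
have fx := integrable_fin_num measurableT intx.
rewrite -(fineK fx) -EFinN => -[xN]; congr EFin; lra.
Qed.

End normal_moments.

(** * Conditional variance *)

Section conditional_variance.
Context d d' (T : measurableType d) (T' : measurableType d') (R : realType).
Variables (P : probability T R) (Y : T -> T').
Hypothesis mY : measurable_fun setT Y.

Lemma g_sigma_algebra_preimage_measurable A :
  g_sigma_algebra_preimage Y A -> measurable A.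
Proof. by move=> [B mB <-]; exact: mY. Qed.

Lemma g_sigma_algebra_preimageT : g_sigma_algebra_preimage Y setT.
Proof. by exists setT => //; rewrite preimage_setT setIT. Qed.

(** The event M < M' belongs to the sub-sigma-algebra, so [M] and [M'] both integrate over it to the
    integral of [X]. There M' - M is positive with integral 0, which forces the event to be null. *)
Lemma cond_expectation_lt_null (X M M' : T -> R) :
  is_cond_expectation P (g_sigma_algebra_preimage Y) X M ->
  is_cond_expectation P (g_sigma_algebra_preimage Y) X M' ->
  P [set t | M t < M' t] = 0%E.
Proof.
move=> [iX iM mM XM] [_ iM' mM' XM'].
have GA : g_sigma_algebra_preimage Y [set t | M t < M' t].
  (* Measurability in [T] would not be enough for a test event; the comparison is made with [T]
     carrying the sigma-algebra generated by [Y]. *)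
  have mG (Z : T -> R) :
      (forall B : set R, measurable B -> g_sigma_algebra_preimage Y (Z @^-1` B)) ->
      measurable_fun setT (Z : g_sigma_algebra_preimageType Y -> R).
    by move=> GZ _ B mB; rewrite setTI; exact: GZ.
  have := measurable_fun_ltr (mG _ mM) (mG _ mM').
  by move=> /(_ measurableT [set true] Logic.I); rewrite setTI.
have mA := g_sigma_algebra_preimage_measurable GA.
set A := [set t | _] in GA mA *.
have iMA := integrableS measurableT mA (@subsetT _ _) iM.
have iMA' := integrableS measurableT mA (@subsetT _ _) iM'.
have /(ae_eq_integral_abs P mA) : measurable_fun A ((EFin \o M') \- (EFin \o M))%E.
  exact: measurable_int (integrableB mA iMA' iMA).
case=> + _; rewrite (eq_integral ((EFin \o M') \- (EFin \o M))%E); last first.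
  by move=> t /set_mem /= tA; rewrite ger0_norm// subr_ge0 ltW.
rewrite integralB// XM// XM'// subee ?integrable_fin_num//; last first.
  exact: integrableS iX.
move=> /(_ erefl) [N [mN PN AN]].
apply: subset_measure0 PN => // t At; apply: AN => /= /(_ At)/eqP.
by rewrite -EFinB eqe subr_eq0 gt_eqF.
Qed.

Lemma cond_expectation_ae_unique (X M M' : T -> R) :
  is_cond_expectation P (g_sigma_algebra_preimage Y) X M ->
  is_cond_expectation P (g_sigma_algebra_preimage Y) X M' ->
  ae_eq P setT M M'.
Proof.
move=> XM XM'; have lt0 := cond_expectation_lt_null XM XM'.
have gt0 := cond_expectation_lt_null XM' XM.
have mM (Z : T -> R) : is_cond_expectation P (g_sigma_algebra_preimage Y) X Z ->
    measurable_fun setT Z.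
  by move=> [_ iZ _ _]; apply/measurable_EFinP; exact: measurable_int iZ.
have mlt (Z Z' : T -> R) : measurable_fun setT Z -> measurable_fun setT Z' ->
    measurable [set t | Z t < Z' t].
  move=> mZ mZ'; have := measurable_fun_ltr mZ mZ'.
  by move=> /(_ measurableT [set true] Logic.I); rewrite setTI.
exists ([set t | M t < M' t] `|` [set t | M' t < M t]); split.
- by apply: measurableU; apply: mlt; exact: mM.
- apply: null_set_setU => //; apply: mlt; exact: mM.
- move=> t /= /not_implyP[_ /eqP]; rewrite neq_lt.
  by move=> /orP[]; [left|right].
Qed.

(** Integrating over the whole space turns either constant into the mean of (X - M)^2, which does
    not depend on the version [M] of the conditional expectation. *)
Lemma cond_variance_unique (X : T -> R) (v v' : R) :
  is_cond_variance P (g_sigma_algebra_preimage Y) X (cst v) ->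
  is_cond_variance P (g_sigma_algebra_preimage Y) X (cst v') -> v = v'.
Proof.
move=> [M XM [iVM _ _ VM]] [M' XM' [iVM' _ _ VM']].
have GT := g_sigma_algebra_preimageT.
have := VM _ GT; have := VM' _ GT.
have int_cst (r : R) : (\int[P]_(t in setT) (cst r t)%:E = r%:E)%E.
  by rewrite [LHS](integral_cst P measurableT r%:E) [X in (_ * X)%E](probability_setT P) mule1.
rewrite !int_cst => v'E vE; apply: EFin_inj; rewrite v'E vE.
apply: ae_eq_integral.
- exact: measurableT.
- exact: measurable_int iVM.
- exact: measurable_int iVM'.
- have := cond_expectation_ae_unique XM XM'.
  by apply: filterS => t /= /(_ Logic.I) ->.
Qed.

Lemma det_cond_varianceE (X : T -> R) (v : R) :
  is_cond_variance P (g_sigma_algebra_preimage Y) X (cst v) ->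
  det_cond_variance P (g_sigma_algebra_preimage Y) X = v.
Proof.
move=> Xv; rewrite /det_cond_variance.
by case: xgetP => [_ -> /cond_variance_unique|/(_ v)//]; exact.
Qed.

Section normal_residual.
Variables (X : T -> R) (m : T' -> R) (s : R).
Hypotheses (mX : measurable_fun setT X) (mm : measurable_fun setT m).
Hypothesis s0 : s != 0.

Let Z (t : T) : measurableTypeR R := X t - m (Y t).

Hypothesis residual_normal : forall (A : set R) (B : set T'),
  measurable A -> measurable B ->
  P (Z @^-1` A `&` Y @^-1` B) = (normal_prob 0 s A * P (Y @^-1` B))%E.

Let mZ : measurable_fun setT Z.
Proof. by apply: measurable_funB => //; exact: measurableT_comp. Qed.

(** By [residual_normal], the image under [Z] of [P] restricted to [Y] in B has the constant density
    P(Y in B) with respect to the normal law. *)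
Lemma ge0_integral_normal_residual (f : R -> \bar R) (B : set T') :
  measurable_fun setT f -> (forall x, (0 <= f x)%E) -> measurable B ->
  (\int[P]_(t in Y @^-1` B) f (Z t) =
   \int[normal_prob 0 s]_x f x * P (Y @^-1` B))%E.
Proof.
move=> mf f0 mB; have mD : measurable (Y @^-1` B).
  by rewrite -[X in measurable X]setTI; exact: mY.
have PD : (fine (P (Y @^-1` B)))%:E = P (Y @^-1` B) by rewrite fineK ?fin_num_measure.
have mfZ : measurable_fun setT (f \o Z) by exact: measurableT_comp.
transitivity (\int[mrestr P mD]_t f (Z t))%E.
  rewrite (@ge0_integral_density _ _ _ P _ (\1_(Y @^-1` B)))//.
  - rewrite [LHS]integral_mkcond; apply: eq_integral => t _.
    by rewrite patchE indicE; case: ifPn => _; rewrite ?mule1 ?mule0.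
  - by move=> A mA; rewrite integral_indic// setIC.
transitivity (\int[pushforward (mrestr P mD) Z]_x f x)%E.
  by rewrite ge0_integral_pushforward.
rewrite (@ge0_integral_density _ _ _ (normal_prob 0 s) _
    (cst (fine (P (Y @^-1` B)))))//.
- by rewrite /cst ge0_integralZr// ?PD// lee_fin fine_ge0.
- by move=> x; rewrite fine_ge0.
- move=> A mA.
  rewrite [RHS](integral_cst (normal_prob 0 s) mA (fine (P (Y @^-1` B)))%:E) PD.
  by rewrite [RHS]muleC -residual_normal.
Qed.

Lemma integrable_normal_residual : P.-integrable setT (EFin \o Z).
Proof.
apply/integrableP; split; first exact/measurable_EFinP.
have := @ge0_integral_normal_residual (fun x => `|x%:E|%E) setT.
rewrite preimage_setT => -> //.
- rewrite [X in (_ * X)%E](probability_setT P) mule1.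
  by have /integrableP[] := integrable_normal_prob s0.
- by apply: measurableT_comp => //; exact/measurable_EFinP.
Qed.

(** The positive and negative parts of the identity have equal integrals under the centred normal
    law, and conditioning on [Y] in B multiplies both by the same probability. *)
Lemma integral_normal_residual (B : set T') : measurable B ->
  (\int[P]_(t in Y @^-1` B) (Z t)%:E = 0)%E.
Proof.
move=> mB; pose e (x : R) := x%:E.
have me : measurable_fun setT e by exact/measurable_EFinP.
have ie : (normal_prob 0 s).-integrable setT e by exact: integrable_normal_prob.
have fp := integrable_pos_fin_num measurableT ie.
have fn := integrable_neg_fin_num measurableT ie.
rewrite -[LHS]/(\int[P]_(t in Y @^-1` B) (e \o Z) t)%E integralE.
rewrite funepos_comp funeneg_comp.
rewrite (ge0_integral_normal_residual (measurable_funepos me))//.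
rewrite (ge0_integral_normal_residual (measurable_funeneg me))//.
have : (\int[normal_prob 0 s]_x e x = 0)%E by exact: integral_normal_prob.
rewrite integralE -(fineK fp) -(fineK fn) -EFinB => -[/eqP].
rewrite subr_eq0 => /eqP ->.
by rewrite subee// fin_numM// fin_num_measure// -[X in measurable X]setTI; exact: mY.
Qed.

Lemma integral_sqr_normal_residual (B : set T') : measurable B ->
  (\int[P]_(t in Y @^-1` B) (Z t ^+ 2)%:E = (s ^+ 2)%:E * P (Y @^-1` B))%E.
Proof.
move=> mB; rewrite (@ge0_integral_normal_residual (fun x => (x ^+ 2)%:E))//.
- by rewrite integral_sqr_normal_prob.
- by apply/measurable_EFinP; exact: measurable_funX.
- by move=> x; rewrite lee_fin sqr_ge0.
Qed.

Lemma is_cond_variance_normal_residual :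
  P.-integrable setT (EFin \o X) ->
  is_cond_variance P (g_sigma_algebra_preimage Y) X (cst (s ^+ 2)).
Proof.
move=> iX; exists (m \o Y).
  have iM : P.-integrable setT (EFin \o (m \o Y)).
    have := integrableB measurableT iX integrable_normal_residual.
    apply: eq_integrable => // t _ /=; rewrite -EFinB /Z; congr EFin; ring.
  split => //.
    move=> B mB; exists (m @^-1` B); last by rewrite setTI.
    by rewrite -[X in measurable X]setTI; exact: mm.
  move=> _ [B mB <-]; rewrite setTI.
  have mD : measurable (Y @^-1` B) by rewrite -[X in measurable X]setTI; exact: mY.
  transitivity (\int[P]_(t in Y @^-1` B) ((EFin \o (m \o Y)) t + (EFin \o Z) t))%E.
    rewrite integralD//.
    - by rewrite [X in (_ + X)%E]integral_normal_residual// adde0.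
    - exact: integrableS iM.
    - exact: integrableS integrable_normal_residual.
  by apply: eq_integral => t _ /=; rewrite -EFinD; congr EFin; rewrite /Z; ring.
have iZ2 : P.-integrable setT (fun t => ((X t - m (Y t)) ^+ 2)%:E).
  apply/integrableP; split.
    by apply/measurable_EFinP; apply: measurable_funX; exact: mZ.
  under eq_integral do rewrite gee0_abs ?lee_fin ?sqr_ge0//.
  have := @integral_sqr_normal_residual setT measurableT.
  by rewrite preimage_setT => ->; rewrite [X in (_ * X)%E](probability_setT P) mule1 ltry.
split => //.
- exact: finite_measure_integrable_cst.
- move=> B mB; rewrite preimage_cst; case: ifPn => _.
    exact: g_sigma_algebra_preimageT.
  by exists set0 => //; rewrite preimage_set0 setI0.
- move=> _ [B mB <-]; rewrite setTI integral_sqr_normal_residual//.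
  have mD : measurable (Y @^-1` B) by rewrite -[X in measurable X]setTI; exact: mY.
  by rewrite [LHS](integral_cst P mD (s ^+ 2)%:E).
Qed.

End normal_residual.

End conditional_variance.

(** * Posterior distribution from a joint density *)

Section posterior.
Context d d' (T : measurableType d) (T' : measurableType d') (R : realType).
Variables (P : probability T R) (w : T -> measurableTypeR R) (Y : T -> T').
Hypotheses (mw : measurable_fun setT w) (mY : measurable_fun setT Y).
Variable nu : {sigma_finite_measure set T' -> \bar R}.
Local Notation mu := (@lebesgue_measure R).
Variable rho : measurableTypeR R * T' -> R.
Hypotheses (mrho : measurable_fun setT rho) (rho0 : forall z, 0 <= rho z).
Local Notation K := (density_measure (mu \x nu)%E mrho rho0).

Lemma density_rectangleE (A : set (measurableTypeR R)) (B : set T') :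
  measurable A -> measurable B ->
  (K (A `*` B) = \int[mu]_(x in A) \int[nu]_(y in B) (rho (x, y))%:E)%E.
Proof.
move=> mA mB; have mAB : measurable (A `*` B) by exact: measurableX.
rewrite /density_measure integral_mkcond fubini_tonelli1; last 2 first.
- by apply/(measurable_restrictT _ _).1 => //; exact/measurable_EFinP/measurable_funTS.
- by move=> z; apply: erestrict_ge0 => y _; rewrite lee_fin.
rewrite [RHS]integral_mkcond; apply: eq_integral => x _.
rewrite /fubini_F patchE; case: ifPn => xA.
  rewrite [RHS]integral_mkcond; apply: eq_integral => y _.
  by rewrite !patchE in_setX xA.
by apply: integral0_eq => y _; rewrite patchE in_setX (negbTE xA).
Qed.

Hypothesis wY_rectangle : forall (A : set (measurableTypeR R)) (B : set T'),
  measurable A -> measurable B -> P (w @^-1` A `&` Y @^-1` B) = K (A `*` B).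

(** Needed for sets other than rectangles, namely the sheared sets of [measurable_residual]. *)
Lemma joint_density (E : set (measurableTypeR R * T')) : measurable E ->
  P [set t | E (w t, Y t)] = K E.
Proof.
have mwY : measurable_fun setT (fun t => (w t, Y t)) by exact: measurable_fun_pair.
move=> mE; rewrite -[LHS]/(pushforward P (fun t => (w t, Y t)) E).
apply: measure_prod_unique => //.
by rewrite [ltLHS](probability_setT P) ltry.
Qed.

Variables (m : T' -> R) (s : R).
Hypotheses (mm : measurable_fun setT m) (s0 : s != 0).
(* The factor [c] is read off at [x = 0]; this spares computing the marginal
   density of [Y]. *)
Let c (y : T') : R := rho (0, y) / normal_pdf (m y) s 0.
Hypothesis rhoE : forall x y, rho (x, y) = c y * normal_pdf (m y) s x.

Let c0 y : 0 <= c y. Proof. by rewrite divr_ge0 ?normal_pdf_ge0. Qed.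

Let mc : measurable_fun setT c.
Proof.
(* The reciprocal of a Gaussian density is itself a constant times an exponential, which makes the
   quotient a product of measurable functions. *)
rewrite /c (_ : (fun _ => _) = fun y =>
    rho (0, y) * ((normal_peak s)^-1 * expR ((0 - m y) ^+ 2 / (s ^+ 2 *+ 2)))).
  apply: measurable_funM; first by apply: measurableT_comp => //; exact: measurable_fun_pair.
  apply: measurable_funM => //; apply: measurableT_comp => //.
  by apply: measurable_funM => //; apply: measurable_funX; exact: measurable_funB.
by apply/funext => y; rewrite normal_pdfE// /normal_fun mulNr expRN invfM (invrK (expR _)).
Qed.

Lemma measurable_residual (A : set R) (B : set T') :
  measurable A -> measurable B ->
  measurable [set z : measurableTypeR R * T' | A (z.1 - m z.2) /\ B z.2].
Proof.
move=> mA mB; apply: measurableI.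
  have mf : measurable_fun setT (fun z : measurableTypeR R * T' => z.1 - m z.2).
    by apply: measurable_funB => //; exact: measurableT_comp.
  by rewrite -[X in measurable X]setTI; exact: mf.
by rewrite -[X in measurable X]setTI; exact: measurable_snd.
Qed.

(** On the slice at y, the shift of [A] by m(y) cancels the mean of the density, so every slice
    contributes c(y) times the same number. *)
Lemma density_residualE (A : set R) (B : set T') :
  measurable A -> measurable B ->
  (K [set z | A (z.1 - m z.2)%R /\ B z.2] =
   normal_prob 0 s A * \int[nu]_(y in B) (c y)%:E)%E.
Proof.
move=> mA mB; have mE := measurable_residual mA mB.
set E := [set z | _] in mE *.
rewrite /density_measure integral_mkcond fubini_tonelli2; last 2 first.
- by apply/(measurable_restrictT _ _).1 => //; exact/measurable_EFinP/measurable_funTS.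
- by move=> z; apply: erestrict_ge0 => y _; rewrite lee_fin.
rewrite -ge0_integralZl//; last 2 first.
- exact/measurable_EFinP/measurable_funTS.
- by move=> y _; rewrite lee_fin.
rewrite [RHS]integral_mkcond; apply: eq_integral => y _.
rewrite /fubini_G patchE; case: ifPn => yB.
  transitivity (\int[mu]_(x in [set x | A (x - m y)%R]) ((c y)%:E * (normal_pdf (m y) s x)%:E))%E.
    rewrite [RHS]integral_mkcond; apply: eq_integral => x _.
    rewrite !patchE -EFinM rhoE (_ : (x, y) \in E = (x \in [set x | A (x - m y)]))//.
    apply/idP/idP; rewrite !inE/=; first by case.
    by split=> //; exact: set_mem.
  rewrite ge0_integralZl//.
  - by rewrite normal_prob_shift// muleC.
  - have mf : measurable_fun setT (fun x : measurableTypeR R => x - m y).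
      exact: measurable_funB.
    by rewrite -[X in measurable X]setTI; exact: mf.
  - by apply/measurable_EFinP/measurable_funTS; exact: measurable_normal_pdf.
  - by move=> x _; rewrite lee_fin normal_pdf_ge0.
  - by rewrite lee_fin.
apply: integral0_eq => x _; rewrite patchE ifF//.
by apply/negP => /set_mem[_ By]; move/negP: yB; apply; rewrite inE.
Qed.

Lemma posterior_residual_normal (A : set R) (B : set T') :
  measurable A -> measurable B ->
  P ((fun t => w t - m (Y t)) @^-1` A `&` Y @^-1` B) =
  (normal_prob 0 s A * P (Y @^-1` B))%E.
Proof.
have residualE (A' : set R) (B' : set T') : measurable A' -> measurable B' ->
    P ((fun t => w t - m (Y t)) @^-1` A' `&` Y @^-1` B') =
    (normal_prob 0 s A' * \int[nu]_(y in B') (c y)%:E)%E.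
  move=> mA mB; rewrite -density_residualE// -joint_density//.
  exact: measurable_residual.
move=> mA mB; rewrite residualE//; congr (_ * _)%E.
(* Choosing [setT] for the residual identifies the integral of [c] over [B] with P(Y in B). *)
have := residualE setT B measurableT mB.
by rewrite preimage_setT setTI [X in (X * _)%E](probability_setT (normal_prob 0 s)) mul1e.
Qed.

End posterior.

(** * Normal kernels and the law of the state *)

Section signals.
Context d (T : measurableType d) (R : realType) (P : probability T R).
Local Notation mu := (@lebesgue_measure R).
Implicit Types (A B : set R) (s : R).

Lemma measurable_normal_pdf2 s : s != 0 ->
  measurable_fun setT (fun z : measurableTypeR R * measurableTypeR R =>
    normal_pdf z.1 s z.2).
Proof.
move=> s0; rewrite (_ : (fun _ => _) = fun z => normal_pdf 0 s (z.2 - z.1)).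
  apply: measurableT_comp; first exact: measurable_normal_pdf.
  exact: measurable_funB.
by apply/funext => z; rewrite normal_pdf_shift.
Qed.

(** As a function of the mean, this is a partial integral of a jointly measurable density, so
    Tonelli applies. *)
Lemma measurable_normal_prob_mean s B : s != 0 -> measurable B ->
  measurable_fun setT (fun x : measurableTypeR R => normal_prob x s B).
Proof.
move=> s0 mB.
rewrite (_ : (fun _ => _) = fubini_F mu
  (fun z : measurableTypeR R * measurableTypeR R =>
    ((normal_pdf z.1 s z.2)%:E * (\1_B z.2)%:E)%E)).
  apply: measurable_fun_fubini_tonelli_F.
    apply: emeasurable_funM.
      by apply/measurable_EFinP; exact: measurable_normal_pdf2.
    by apply/measurable_EFinP; apply: measurableT_comp.
  by move=> z; rewrite mule_ge0// lee_fin normal_pdf_ge0.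
apply/funext => x; rewrite /normal_prob /fubini_F [LHS]integral_mkcond.
apply: eq_integral => y _; rewrite patchE indicE.
by case: ifPn => _; rewrite ?mule1 ?mule0.
Qed.

Lemma ge0_integral_normal_state (w : {RV P >-> R}) s (f : R -> \bar R) A :
  s != 0 ->
  (forall B, measurable B -> distribution P w B = normal_prob 0 s B) ->
  measurable_fun setT (f : measurableTypeR R -> _) -> (forall x, 0 <= f x)%E ->
  measurable A ->
  (\int[P]_(t in w @^-1` A) f (w t) =
   \int[mu]_(x in A) (f x * (normal_pdf 0 s x)%:E))%E.
Proof.
move=> s0 wN mf f0 mA.
have mw : measurable_fun setT (w : T -> measurableTypeR R).
  exact: (measurable_funP w).
rewrite [RHS]integral_mkcond.
transitivity (\int[mu]_x ((f \_ A) x * (normal_pdf 0 s x)%:E))%E; last first.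
  by apply: eq_integral => x _; rewrite !patchE; case: ifPn => // _; rewrite mul0e.
rewrite -(@ge0_integral_density _ _ _ mu (normal_prob 0 s)).
- rewrite -integral_mkcond.
  transitivity (\int[pushforward P (w : T -> measurableTypeR R)]_(x in A) f x)%E.
    rewrite ge0_integral_pushforward//.
    exact: measurable_funTS.
  by apply: eq_measure_integral => B mB _; exact: wN.
- exact: measurable_normal_pdf.
- by move=> x; exact: normal_pdf_ge0.
- by [].
- by apply/(measurable_restrictT _ _).1 => //; exact: measurable_funTS.
- by move=> x; apply: erestrict_ge0.
Qed.

End signals.

(** * Completing the square *)

Section precision.
Context (R : realType).
Implicit Types (p m x y : R).

Lemma sqrt_precision_neq0 p : 0 < p -> Num.sqrt (1 / p) != 0.
Proof. by move=> p0; rewrite gt_eqF// sqrtr_gt0 divr_gt0. Qed.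

Lemma normal_pdf_precision p m x : 0 < p ->
  normal_pdf m (Num.sqrt (1 / p)) x =
  normal_peak (Num.sqrt (1 / p)) * expR (- (p / 2 * (x - m) ^+ 2)).
Proof.
move=> p0; rewrite normal_pdfE ?sqrt_precision_neq0// /normal_fun.
rewrite sqr_sqrtr; last by rewrite divr_ge0// ltW.
by congr (_ * expR _); field; rewrite gt_eqF.
Qed.

Lemma normal_pdf_gt0 p m x : 0 < p -> 0 < normal_pdf m (Num.sqrt (1 / p)) x.
Proof.
move=> p0; rewrite normal_pdf_precision// mulr_gt0 ?expR_gt0//.
exact/normal_peak_gt0/sqrt_precision_neq0.
Qed.

(** Precisions add and the posterior mean is the precision-weighted average with prior mean 0. The
    form f 0 / g 0 is the factor [c] that the posterior section expects. *)
Lemma normal_pdf_posterior1 p0 p1 x y : 0 < p0 -> 0 < p1 ->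
  let f z := normal_pdf 0 (Num.sqrt (1 / p0)) z *
             normal_pdf z (Num.sqrt (1 / p1)) y in
  let g z := normal_pdf (p1 * y / (p0 + p1)) (Num.sqrt (1 / (p0 + p1))) z in
  f x = f 0 / g 0 * g x.
Proof.
move=> hp0 hp1 f g; have hp : 0 < p0 + p1 by rewrite addr_gt0.
have g0 : g 0 != 0 by rewrite gt_eqF// normal_pdf_gt0.
apply: (mulIf g0); rewrite [RHS]mulrAC divfK// /f /g !normal_pdf_precision//.
set k0 := normal_peak _; set k1 := normal_peak _; set k := normal_peak _.
(* With [g 0] cleared, both sides carry the same constants; gathering the exponentials leaves a
   rational identity between exponents. *)
rewrite [LHS](_ : _ = k0 * k1 * k * expR (- (p0 / 2 * (x - 0) ^+ 2)
  - (p1 / 2 * (y - x) ^+ 2) - ((p0 + p1) / 2 * (0 - p1 * y / (p0 + p1)) ^+ 2))).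
  rewrite [RHS](_ : _ = k0 * k1 * k * expR (- (p0 / 2 * (0 - 0) ^+ 2)
  - (p1 / 2 * (y - 0) ^+ 2) - ((p0 + p1) / 2 * (x - p1 * y / (p0 + p1)) ^+ 2))).
    by congr (_ * expR _); field; rewrite gt_eqF.
  by rewrite !expRD; ring.
by rewrite !expRD; ring.
Qed.

Lemma normal_pdf_posterior2 p0 p1 p2 x y1 y2 : 0 < p0 -> 0 < p1 -> 0 < p2 ->
  let f z := normal_pdf 0 (Num.sqrt (1 / p0)) z *
    (normal_pdf z (Num.sqrt (1 / p1)) y1 * normal_pdf z (Num.sqrt (1 / p2)) y2) in
  let g z := normal_pdf ((p1 * y1 + p2 * y2) / (p0 + p1 + p2))
    (Num.sqrt (1 / (p0 + p1 + p2))) z in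
  f x = f 0 / g 0 * g x.
Proof.
move=> hp0 hp1 hp2 f g; have hp : 0 < p0 + p1 + p2 by rewrite !addr_gt0.
have g0 : g 0 != 0 by rewrite gt_eqF// normal_pdf_gt0.
apply: (mulIf g0); rewrite [RHS]mulrAC divfK// /f /g !normal_pdf_precision//.
set k0 := normal_peak _; set k1 := normal_peak _; set k2 := normal_peak _.
set k := normal_peak _; set m := (p1 * y1 + p2 * y2) / _.
rewrite [LHS](_ : _ = k0 * k1 * k2 * k * expR (- (p0 / 2 * (x - 0) ^+ 2)
  - (p1 / 2 * (y1 - x) ^+ 2) - (p2 / 2 * (y2 - x) ^+ 2)
  - ((p0 + p1 + p2) / 2 * (0 - m) ^+ 2))).
  rewrite [RHS](_ : _ = k0 * k1 * k2 * k * expR (- (p0 / 2 * (0 - 0) ^+ 2)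
  - (p1 / 2 * (y1 - 0) ^+ 2) - (p2 / 2 * (y2 - 0) ^+ 2)
  - ((p0 + p1 + p2) / 2 * (x - m) ^+ 2))).
    by congr (_ * expR _); rewrite /m; field; rewrite gt_eqF.
  by rewrite !expRD; ring.
by rewrite !expRD; ring.
Qed.

End precision.

(** * Gaussian signals *)

(* The library equips [m1 \x m2] with a sigma-finite structure only when [m1]
   and [m2] are subprobabilities. *)
Section sigma_finite_product.
Local Open Scope ereal_scope.
Context d1 d2 (T1 : measurableType d1) (T2 : measurableType d2) (R : realType).
Variables (m1 : {sigma_finite_measure set T1 -> \bar R})
          (m2 : {sigma_finite_measure set T2 -> \bar R}).

Definition sigma_finite_product := m1 \x m2.

HB.instance Definition _ := Measure.on sigma_finite_product.

Let sigma_finite_productT : sigma_finite setT sigma_finite_product.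
Proof.
have /sigma_finiteP[F [TF ndF Foo]] := sigma_finiteT m1.
have /sigma_finiteP[G [TG ndG Goo]] := sigma_finiteT m2.
exists (fun n => F n `*` G n) => [|n].
  apply/seteqP; split => // -[x y] _.
  have [i _ Fx] : (\bigcup_n F n) x by rewrite -TF.
  have [j _ Gy] : (\bigcup_n G n) y by rewrite -TG.
  exists (maxn i j) => //; split => /=.
  - by move: x Fx; exact/subsetPset/ndF/leq_maxl.
  - by move: y Gy; exact/subsetPset/ndG/leq_maxr.
have [mF F_fin] := Foo n; have [mG G_fin] := Goo n.
split; first exact: measurableX.
by rewrite [ltLHS]product_measure1E// lte_mul_pinfty// ge0_fin_numE.
Qed.

HB.instance Definition _ := Measure_isSigmaFinite.Build _ _ _
  sigma_finite_product sigma_finite_productT.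

End sigma_finite_product.

Section gaussian_posteriors.
Context d (T : measurableType d) (R : realType) (P : probability T R).
Local Notation mu := (@lebesgue_measure R).
Local Notation sigma p := (Num.sqrt (1 / p)).
Variables (w : {RV P >-> R}) (p0 : R).
Hypothesis hp0 : 0 < p0.
Hypothesis w_normal : forall B, measurable B ->
  distribution P w B = normal_prob 0 (sigma p0) B.

Let s0 : sigma p0 != 0. Proof. exact: sqrt_precision_neq0. Qed.

Let mw : measurable_fun setT (w : T -> measurableTypeR R).
Proof. exact: (measurable_funP w). Qed.

Lemma cond_probability_state (E : set T) (g : R -> R) (A : set R) :
  is_cond_probability P (g_sigma_algebra_preimage w) E (g \o w) ->
  measurable E -> measurable_fun setT (g : measurableTypeR R -> R) ->
  (forall x, 0 <= g x) -> measurable A ->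
  P (w @^-1` A `&` E) =
  (\int[mu]_(x in A) ((g x)%:E * (normal_pdf 0 (sigma p0) x)%:E))%E.
Proof.
move=> [_ _ _ gE] mE mg g0 mA.
have mwA : measurable (w @^-1` A) by rewrite -[X in measurable X]setTI; exact: mw.
rewrite -(@ge0_integral_normal_state _ _ _ _ w (sigma p0) (EFin \o g))//.
  have /gE -> : g_sigma_algebra_preimage w (w @^-1` A) by exists A; rewrite ?setTI.
  by rewrite integral_indic// setIC.
by apply/measurable_EFinP.
Qed.

Lemma integrable_state : P.-integrable setT (EFin \o w).
Proof.
apply/integrableP; split; first exact/measurable_EFinP.
have := @ge0_integral_normal_state _ _ _ P w (sigma p0) (fun x => `|x%:E|%E) setT.
rewrite preimage_setT => -> //; last first.
  by apply: measurableT_comp => //; exact/measurable_EFinP.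
rewrite -(@ge0_integral_density _ _ _ mu (normal_prob 0 (sigma p0)))//.
- by have /integrableP[] := integrable_normal_prob s0.
- exact: measurable_normal_pdf.
- by move=> x; exact: normal_pdf_ge0.
- by apply: measurableT_comp => //; exact/measurable_EFinP.
Qed.

Lemma measurable_fine_normal_prob p B : 0 < p -> measurable B ->
  measurable_fun setT (fun x : measurableTypeR R => fine (normal_prob x (sigma p) B)).
Proof.
move=> hp mB; apply: measurableT_comp; first exact: fine_measurable.
by apply: measurable_normal_prob_mean => //; exact: sqrt_precision_neq0.
Qed.

Lemma fine_normal_probK m s (B : set R) : measurable B ->
  (fine (normal_prob m s B))%:E = normal_prob m s B.
Proof. by move=> mB; rewrite fineK// (fin_num_measure (normal_prob _ _)). Qed.

Section one_signal.
Variables (y : {RV P >-> R}) (p : R).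
Hypotheses (hp : 0 < p) (y_normal : cond_normal P w y p).

Let my : measurable_fun setT (y : T -> measurableTypeR R).
Proof. exact: (measurable_funP y). Qed.

Let rho (z : measurableTypeR R * measurableTypeR R) : R :=
  normal_pdf 0 (sigma p0) z.1 * normal_pdf z.1 (sigma p) z.2.

Let mrho : measurable_fun setT rho.
Proof.
apply: measurable_funM; last first.
  by apply: measurable_normal_pdf2; exact: sqrt_precision_neq0.
by apply: measurableT_comp => //; exact: measurable_normal_pdf.
Qed.

Let rho0 z : 0 <= rho z. Proof. by rewrite mulr_ge0 ?normal_pdf_ge0. Qed.

Lemma state_signal_rectangle (A B : set (measurableTypeR R)) :
  measurable A -> measurable B ->
  P (w @^-1` A `&` y @^-1` B) = density_measure (mu \x mu)%E mrho rho0 (A `*` B).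
Proof.
move=> mA mB; rewrite density_rectangleE//.
rewrite (@cond_probability_state _
  (fun x => fine (normal_prob x (sigma p) B)))//; last 4 first.
- exact: y_normal.
- by rewrite -[X in measurable X]setTI; exact: my.
- exact: measurable_fine_normal_prob.
- by move=> x; rewrite fine_ge0.
apply: eq_integral => x _; rewrite fine_normal_probK// /rho muleC.
under [RHS]eq_integral do rewrite /= EFinM.
rewrite ge0_integralZl ?lee_fin ?normal_pdf_ge0//.
- by apply/measurable_EFinP/measurable_funTS; exact: measurable_normal_pdf.
- by move=> z _; rewrite lee_fin normal_pdf_ge0.
Qed.

Lemma det_cond_variance_signal :
  det_cond_variance P (g_sigma_algebra_preimage y) w = 1 / (p0 + p).
Proof.
have hpp : 0 < p0 + p by rewrite addr_gt0.
pose m (z : measurableTypeR R) : R := p * z / (p0 + p).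
have mm : measurable_fun setT m by apply: measurable_funM => //; exact: measurable_funM.
have spp := sqrt_precision_neq0 hpp.
apply: det_cond_varianceE; first exact: my.
rewrite (_ : 1 / (p0 + p) = sigma (p0 + p) ^+ 2); last first.
  by rewrite sqr_sqrtr// divr_ge0// ltW.
apply: (@is_cond_variance_normal_residual _ _ _ _ _ _ _ _ _ m) => //;
  last exact: integrable_state.
apply: (@posterior_residual_normal _ _ _ _ _ _ _ _ _ _ mu rho mrho rho0 _ m) => //.
- exact: state_signal_rectangle.
- by move=> x z; exact: normal_pdf_posterior1.
Qed.

End one_signal.

Section two_signals.
Variables (y1 y2 y3 : {RV P >-> R}) (p1 p2 p3 : R).
Hypotheses (hp1 : 0 < p1) (hp2 : 0 < p2).
Hypotheses (y1_normal : cond_normal P w y1 p1) (y2_normal : cond_normal P w y2 p2).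
Hypotheses (y3_normal : cond_normal P w y3 p3).
Hypothesis y_indep : cond_independent3 P (g_sigma_algebra_preimage w) y1 y2 y3.

Local Notation R2 := (measurableTypeR R * measurableTypeR R)%type.

Let mu2 : {sigma_finite_measure set R2 -> \bar R} := sigma_finite_product mu mu.

Let Y (t : T) : R2 := (y1 t, y2 t).

Let my1 : measurable_fun setT (y1 : T -> measurableTypeR R).
Proof. exact: (measurable_funP y1). Qed.

Let my2 : measurable_fun setT (y2 : T -> measurableTypeR R).
Proof. exact: (measurable_funP y2). Qed.

Let mY : measurable_fun setT Y. Proof. exact: measurable_fun_pair. Qed.

Let lik (x : R) (z : R2) : R :=
  normal_pdf x (sigma p1) z.1 * normal_pdf x (sigma p2) z.2.

Let mlik x : measurable_fun setT (lik x).
Proof.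
by apply: measurable_funM; apply: measurableT_comp => //; exact: measurable_normal_pdf.
Qed.

Let lik0 x z : 0 <= lik x z. Proof. by rewrite mulr_ge0 ?normal_pdf_ge0. Qed.

Let rho (z : measurableTypeR R * R2) : R :=
  normal_pdf 0 (sigma p0) z.1 * lik z.1 z.2.

Let mrho : measurable_fun setT rho.
Proof.
have mpdf (p : R) (f : R2 -> measurableTypeR R) : 0 < p -> measurable_fun setT f ->
    measurable_fun setT (fun z : measurableTypeR R * R2 =>
      normal_pdf z.1 (sigma p) (f z.2)).
  move=> hp mf.
  have mg : measurable_fun setT
      (fun z : measurableTypeR R * R2 => (z.1, f z.2) : R2).
    by apply: measurable_fun_pair => //; exact: measurableT_comp.
  exact: (measurableT_comp (measurable_normal_pdf2 (sqrt_precision_neq0 hp)) mg).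
apply: measurable_funM.
  by apply: measurableT_comp => //; exact: measurable_normal_pdf.
by apply: measurable_funM; apply: mpdf.
Qed.

Let rho0 z : 0 <= rho z. Proof. by rewrite mulr_ge0 ?normal_pdf_ge0. Qed.

Lemma integral_likelihood_rectangle x (B1 B2 : set (measurableTypeR R)) :
  measurable B1 -> measurable B2 ->
  (\int[mu \x mu]_(z in B1 `*` B2) (lik x z)%:E =
   normal_prob x (sigma p1) B1 * normal_prob x (sigma p2) B2)%E.
Proof.
move=> mB1 mB2; have := density_rectangleE mu (mlik x) (lik0 x) mB1 mB2.
rewrite {1}/density_measure => ->; rewrite /lik/=.
under eq_integral.
  move=> z _; under eq_integral do rewrite EFinM.
  rewrite ge0_integralZl ?lee_fin ?normal_pdf_ge0//; first over.
  - by apply/measurable_EFinP/measurable_funTS; exact: measurable_normal_pdf.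
  - by move=> z' _; rewrite lee_fin normal_pdf_ge0.
rewrite ge0_integralZr//.
- by apply/measurable_EFinP/measurable_funTS; exact: measurable_normal_pdf.
- by move=> z _; rewrite lee_fin normal_pdf_ge0.
- by apply: integral_ge0 => z _; rewrite lee_fin normal_pdf_ge0.
Qed.

Lemma state_signals_rectangle (A B1 B2 : set (measurableTypeR R)) :
  measurable A -> measurable B1 -> measurable B2 ->
  P (w @^-1` A `&` Y @^-1` (B1 `*` B2)) =
  density_measure (mu \x mu2)%E mrho rho0 (A `*` (B1 `*` B2)).
Proof.
move=> mA mB1 mB2; have mB : measurable (B1 `*` B2) by exact: measurableX.
rewrite density_rectangleE//.
pose q p B x : R := fine (normal_prob x (sigma p) B).
have mq p B : 0 < p -> measurable B ->
    measurable_fun setT (q p B : measurableTypeR R -> R).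
  by move=> *; exact: measurable_fine_normal_prob.
have q0 p B x : 0 <= q p B x by rewrite fine_ge0.
rewrite (@cond_probability_state _ (fun x => q p1 B1 x * q p2 B2 x))//; last 4 first.
(* Independence is stated for three signals; [setT] for the third, whose conditional probability is
   1, yields the product rule for the pair. *)
- rewrite [X in is_cond_probability _ _ _ X](_ : _ =
      (fun t => q p1 B1 (w t) * q p2 B2 (w t) * q p3 setT (w t))); last first.
    apply/funext => t /=; rewrite [X in _ = _ * X](_ : _ = 1) ?mulr1//.
    exact: (congr1 fine (probability_setT (normal_prob (w t) (sigma p3)))).
  rewrite [X in is_cond_probability _ _ X _](_ : _ =
      y1 @^-1` B1 `&` y2 @^-1` B2 `&` y3 @^-1` setT); last first.
    by rewrite preimage_setT setIT.
  exact: (y_indep mB1 mB2 measurableT (y1_normal mB1) (y2_normal mB2)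
    (y3_normal measurableT)).
- by rewrite -[X in measurable X]setTI; exact: mY.
- by apply: measurable_funM; exact: mq.
- by move=> x; rewrite mulr_ge0.
have qE x : ((q p1 B1 x * q p2 B2 x)%:E =
    normal_prob x (sigma p1) B1 * normal_prob x (sigma p2) B2)%E.
  by rewrite EFinM; congr (_ * _)%E; exact: fine_normal_probK.
apply: eq_integral => x _; rewrite [X in (X * _)%E = _]qE muleC /rho.
under [RHS]eq_integral do rewrite /= EFinM.
rewrite ge0_integralZl ?lee_fin ?normal_pdf_ge0//.
- by rewrite integral_likelihood_rectangle.
- by apply/measurable_EFinP/measurable_funTS; exact: mlik.
- by move=> z _; rewrite lee_fin lik0.
Qed.

(** For fixed [A], both sides are measures in [B] that agree on rectangles of the plane. To exhibit
    them as measures, each is written as the pushforward of a restriction. *)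
Lemma state_signals_density (A : set (measurableTypeR R)) (B : set R2) :
  measurable A -> measurable B ->
  P (w @^-1` A `&` Y @^-1` B) =
  density_measure (mu \x mu2)%E mrho rho0 (A `*` B).
Proof.
move=> mA mB.
have mwA : measurable (w @^-1` A) by rewrite -[X in measurable X]setTI; exact: mw.
have mAT : measurable (A `*` [set: R2]) by exact: measurableX.
have sndE (B' : set R2) : A `*` B' = @snd (measurableTypeR R) R2 @^-1` B' `&` (A `*` setT).
  by apply/seteqP; split => [[a b] [] //|[a b] [/= ? []]].
rewrite setIC sndE.
rewrite -[LHS]/(pushforward (mrestr P mwA) Y B).
rewrite -[RHS]/(pushforward (mrestr (density_measure (mu \x mu2)%E mrho rho0) mAT)
  (@snd (measurableTypeR R) R2) B).
apply: measure_prod_unique => //.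
- have : (P (Y @^-1` setT `&` w @^-1` A) < +oo)%E.
    by rewrite -ge0_fin_numE// fin_num_measure// preimage_setT setTI.
  exact.
- move=> B1 B2 mB1 mB2; have := state_signals_rectangle mA mB1 mB2.
  by rewrite setIC sndE.
Qed.

Lemma det_cond_variance_signals :
  det_cond_variance P (g_sigma_algebra_preimage (fun t => (y1 t, y2 t))) w =
  1 / (p0 + p1 + p2).
Proof.
have hpp : 0 < p0 + p1 + p2 by rewrite !addr_gt0.
pose m (z : R2) : R := (p1 * z.1 + p2 * z.2) / (p0 + p1 + p2).
have mm : measurable_fun setT m.
  apply: measurable_funM => //; apply: measurable_funD; apply: measurable_funM => //.
have spp := sqrt_precision_neq0 hpp.
apply: det_cond_varianceE; first exact: mY.
rewrite (_ : 1 / (p0 + p1 + p2) = sigma (p0 + p1 + p2) ^+ 2); last first.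
  by rewrite sqr_sqrtr// divr_ge0// ltW.
apply: (@is_cond_variance_normal_residual _ _ _ _ _ _ _ _ _ m) => //;
  last exact: integrable_state.
apply: (@posterior_residual_normal _ _ _ _ _ _ _ _ _ _ _ rho mrho rho0 _ m) => //.
- exact: state_signals_density.
- by move=> x [z1 z2]; exact: normal_pdf_posterior2.
Qed.

End two_signals.
End gaussian_posteriors.

(** * Comparison of the payoffs *)

Lemma component0 (T : Type) (R : realType) (s sc : T -> R) :
  component 0 s sc = s.
Proof.
apply/funext => t; rewrite /component subr0 mul1r mul0r addr0 expr1n expr0n/=.
by rewrite addr0 sqrtr1 divr1.
Qed.

Lemma component1 (T : Type) (R : realType) (s sc : T -> R) :
  component 1 s sc = sc.
Proof.
apply/funext => t; rewrite /component subrr mul1r mul0r add0r expr1n expr0n/=.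
by rewrite add0r sqrtr1 divr1.
Qed.

(** Each residual value subtracts the joint utility once, leaving it with coefficient -1. The two
    residual values list the pair in opposite orders, hence the swap hypothesis. *)
Lemma AoN_payoffE d (T : measurableType d) (R : realType) (P : probability T R)
    (w0 s1 s2 sc : T -> R) (alpha : R) :
  let w1 := component alpha s1 sc in
  let w2 := component alpha s2 sc in
  stopping_utility P w0 (fun t => (w2 t, w1 t)) =
  stopping_utility P w0 (fun t => (w1 t, w2 t)) ->
  AoN_payoff P w0 s1 s2 sc alpha =
  stopping_utility P w0 w1 + stopping_utility P w0 w2
    - stopping_utility P w0 (fun t => (w1 t, w2 t)).
Proof. by move=> w1 w2 swap; rewrite /AoN_payoff/= /residual_value swap; ring. Qed.

Lemma g_sigma_algebra_preimage_swap (T : pointedType) d1 d2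
    (T1 : measurableType d1) (T2 : measurableType d2) (f : T -> T1) (g : T -> T2) :
  g_sigma_algebra_preimage (fun t => (g t, f t)) =
  g_sigma_algebra_preimage (fun t => (f t, g t)).
Proof.
by apply/seteqP; split => _ [B mB <-];
  exists ((fun z => (z.2, z.1)) @^-1` B) => //;
  rewrite -[X in measurable X]setTI; apply: measurable_fun_pair.
Qed.

(** Under full correlation both components are [sc]; this reduces the joint utility to that of a
    single signal. *)
Lemma g_sigma_algebra_preimage_diag (T : pointedType) d
    (T1 : measurableType d) (f : T -> T1) :
  g_sigma_algebra_preimage (fun t => (f t, f t)) = g_sigma_algebra_preimage f.
Proof.
apply/seteqP; split => _ [B mB <-].
  exists ((fun x => (x, x)) @^-1` B) => //.
  by rewrite -[X in measurable X]setTI; apply: measurable_fun_pair.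
exists (fst @^-1` B) => //.
by rewrite -[X in measurable X]setTI; exact: measurable_fst.
Qed.

Theorem corollary4 (R : realType) (p0 p1 p2 : R)
    (hp0 : 0 < p0) (hp1 : 0 < p1) (hp2 : 0 < p2) :
  exists pbar : R, pbar < Num.min p1 p2 /\
    forall pc : R, 0 < pc -> pbar < pc ->
    forall (d : measure_display) (T : measurableType d) (P : probability T R)
      (w0 s1 s2 sc : {RV P >-> R}),
      gaussian_signals p0 p1 p2 pc w0 s1 s2 sc ->
      AoN_payoff P w0 s1 s2 sc 0 < AoN_payoff P w0 s1 s2 sc 1.
Proof.
pose loss := 1 / (p0 + p1) + 1 / (p0 + p2) - 1 / (p0 + p1 + p2).
have lt1 : 1 / (p0 + p1 + p2) < 1 / (p0 + p1).
  by rewrite !div1r ltf_pV2 ?posrE ?addr_gt0// ltrDl.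
have lt2 : 1 / (p0 + p1 + p2) < 1 / (p0 + p2).
  by rewrite !div1r ltf_pV2 ?posrE ?addr_gt0// addrAC ltrDl.
(* Each bound uses the other signal: [loss] exceeds 1 / (p0 + p1) by the amount by which 1 / (p0 +
   p2) exceeds the joint variance. *)
have gt1 : 1 / (p0 + p1) < loss by rewrite /loss; lra.
have gt2 : 1 / (p0 + p2) < loss by rewrite /loss; lra.
have loss0 : 0 < loss by rewrite (lt_trans _ gt1)// divr_gt0// addr_gt0.
exists (loss^-1 - p0); split.
  have inv_loss p : 0 < p -> 1 / p < loss -> loss^-1 < p.
    by move=> p_gt0 lt_loss; rewrite invf_plt ?posrE// -div1r.
  by rewrite lt_min !ltrBlDl !inv_loss//; exact: addr_gt0.
move=> pc hpc; rewrite ltrBlDl => pc_gt d T P w0 s1 s2 sc [w0N s1N s2N scN indep].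
rewrite !AoN_payoffE /stopping_utility ?component0 ?component1; last 2 first.
- by [].
- by rewrite g_sigma_algebra_preimage_swap.
rewrite g_sigma_algebra_preimage_diag.
rewrite (det_cond_variance_signals hp0 w0N hp1 hp2 s1N s2N scN indep).
rewrite (det_cond_variance_signal hp0 w0N hp1 s1N).
rewrite (det_cond_variance_signal hp0 w0N hp2 s2N).
rewrite (det_cond_variance_signal hp0 w0N hpc scN).
have : 1 / (p0 + pc) < loss.
  by rewrite div1r invf_plt ?posrE//; exact: addr_gt0.
rewrite /loss; lra.
Qed.
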